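(* Let $E$ be an $n$-dimensional nilpotent complex evolution algebra whose index of nilpotency is not equal to $2^{n-1}+1$. Then the index of nilpotency of $E$ is not greater than $2^{n-2}+1$.
   Context: An evolution algebra over a field $K$ is a vector space $E$ over $K$ with a bilinear multiplication and a basis $\{e_1,e_2,\dots\}$ (called a natural basis) such that $e_ie_j=0$ for $i\neq j$ and $e_ie_i=\sum_k a_{ik}e_k$; here $K=\mathbb{C}$. Put $E^1=E$, $E^k=\sum_{i=1}^{k-1}E^iE^{k-i}$ for $k\ge2$ (products of subspaces are linear spans of products). $E$ is nilpotent if $E^m=0$ for some $m\in\mathbb{N}$, and the minimal such $m$ is the index of nilpotency. *)

(* Defs.v *)
From HB Require Import structures.
From mathcomp Require Import all_boot all_order all_algebra.
From mathcomp Require Import reals complex.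

Set Implicit Arguments.
Unset Strict Implicit.
Unset Printing Implicit Defensive.

Import GRing.Theory.
Local Open Scope ring_scope.

(* MathComp's algebras are associative, so a possibly non-associative algebra
   is a finite-dimensional vector space E with a bilinear map mul. *)

Definition natural_basis (K : fieldType) (E : vectType K)
    (mul : {bilinear E -> E -> E}) (n : nat) (e : n.-tuple E) : Prop :=
  [/\ basis_of fullv e,
      forall i j : 'I_n, i != j -> mul (tnth e i) (tnth e j) = 0
    & exists a : 'M[K]_n, forall i : 'I_n,
        mul (tnth e i) (tnth e i) = \sum_(k < n) a i k *: tnth e k].

Definition is_evolution_algebra (K : fieldType) (E : vectType K)
    (mul : {bilinear E -> E -> E}) : Prop :=
  exists n (e : n.-tuple E), natural_basis mul e.

(* As for prodv in falgebra.v, products of basis vectors suffice: prodspP. *)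
Definition prodsp (K : fieldType) (E : vectType K)
    (mul : {bilinear E -> E -> E}) (U V : {vspace E}) : {vspace E} :=
  <<[seq mul u v | u <- vbasis U, v <- vbasis V]>>%VS.

(* fuel only makes the course-of-values recursion structural; see powspE. *)
Fixpoint powsp_rec (K : fieldType) (E : vectType K)
    (mul : {bilinear E -> E -> E}) (fuel k : nat) : {vspace E} :=
  if fuel is fuel'.+1 then
    if (k <= 1)%N then fullv
    else (\sum_(1 <= i < k)
            prodsp mul (powsp_rec mul fuel' i) (powsp_rec mul fuel' (k - i)))%VS
  else fullv.

(* E^k; only k >= 1 is meaningful, and powsp mul 0 is the junk value E. *)
Definition powsp (K : fieldType) (E : vectType K)
    (mul : {bilinear E -> E -> E}) (k : nat) : {vspace E} :=
  powsp_rec mul k k.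

Definition nilpotent_algebra (K : fieldType) (E : vectType K)
    (mul : {bilinear E -> E -> E}) : Prop :=
  exists m : nat, (0 < m)%N && (powsp mul m == 0%VS).

Definition nilpotency_index (K : fieldType) (E : vectType K)
    (mul : {bilinear E -> E -> E}) (nil : nilpotent_algebra mul) : nat :=
  ex_minn nil.

Lemma prodspP (K : fieldType) (E : vectType K) (mul : {bilinear E -> E -> E})
    (U V W : {vspace E}) :
  reflect {in U & V, forall u v, mul u v \in W} (prodsp mul U V <= W)%VS.
Proof.
apply: (iffP idP) => [sW u v Uu Vv | UVW].
  apply: (subvP sW); rewrite (coord_vbasis Uu) (coord_vbasis Vv).
  rewrite linear_sumlz; apply: memv_suml => i _.
  rewrite linear_sumr; apply: memv_suml => j _.
  rewrite linearZl_LR linearZr_LR !memvZ // memv_span //.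
  by apply/allpairsP; exists ((vbasis U)`_i, (vbasis V)`_j);
    rewrite /= !mem_nth ?size_tuple.
apply/span_subvP => _ /allpairsP[[u v] /= [Uu Vv ->]].
by apply: UVW; apply: vbasis_mem.
Qed.

Lemma powsp1 (K : fieldType) (E : vectType K) (mul : {bilinear E -> E -> E}) :
  powsp mul 1 = fullv.
Proof. by []. Qed.

Lemma powspE (K : fieldType) (E : vectType K) (mul : {bilinear E -> E -> E})
    (k : nat) : (2 <= k)%N ->
  powsp mul k =
    (\sum_(1 <= i < k) prodsp mul (powsp mul i) (powsp mul (k - i)))%VS.
Proof.
have fuelE f g j : (j <= f)%N -> (j <= g)%N ->
    powsp_rec mul f j = powsp_rec mul g j.
  elim: f g j => [|f IHf] [|g] [|j] //= jf jg.
  case: ifP => // _; rewrite !big_seq; apply: eq_bigr => i.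
  rewrite mem_index_iota => /andP[i0 ij].
  have ji : (j.+1 - i <= j)%N by rewrite leq_subLR -add1n leq_add2r.
  congr (prodsp mul _ _); apply: IHf.
  - exact: leq_trans ij jf.
  - exact: leq_trans ij jg.
  - exact: leq_trans ji jf.
  - exact: leq_trans ji jg.
have stepE f j : (1 < j)%N -> powsp_rec mul f.+1 j =
    (\sum_(1 <= i < j)
        prodsp mul (powsp_rec mul f i) (powsp_rec mul f (j - i)))%VS.
  by rewrite /= ltnNge => /negbTE ->.
case: k => // k k1; rewrite {1}/powsp stepE //.
rewrite !big_seq; apply: eq_bigr => i; rewrite mem_index_iota => /andP[i0 ij].
have ji : (k.+1 - i <= k)%N by rewrite leq_subLR -add1n leq_add2r.
by congr (prodsp mul _ _); apply: fuelE.
Qed.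

(* Main.v *)
Require Import Defs.
From HB Require Import structures.
From mathcomp Require Import all_boot all_order all_algebra.
From mathcomp Require Import reals complex.
From mathcomp Require Import zify.

Set Implicit Arguments.
Unset Strict Implicit.
Unset Printing Implicit Defensive.

Import GRing.Theory.
Local Open Scope ring_scope.

(** Fix a natural basis [e] with structure matrix [a], and read [a] as a
    digraph on the basis indices, with an edge from [i] to [k] when
    [a i k != 0].  Let [S_l] ([walk_ends a l]) be the set of endpoints of walks
    of length [l], and [V_l] the span of the [e_k] with [k] in [S_l].

    Since [x y = \sum_i x_i y_i e_i^2], the product of a vector of [V_l] with
    any vector lies in [V_(l+1)].  In a product of [k > 2^l] factors, one of the
    two outermost factors has more than [2^(l-1)] factors itself, so [E^k] is
    contained in [V_l] as soon as [2^l < 2 k] ([powsp_sub_support]).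

    If [i] ends a walk of length [l], multiplying on the right by the basis
    vectors along the walk shows [e_i^2 \in E^(l+2)] ([walk_square_powsp]); as
    [E] is nilpotent, [S_l] is eventually empty.  The sets [S_l] thus decrease
    strictly until they vanish, and two cases remain.

    - If [S_(n-1)] is empty, then [E^(2^(n-2)+1)] is zero, which is the bound.
    - Otherwise [S_l] has exactly [n - l] elements for [l <= n]
      ([card_walk_ends]), so that the differences [S_l :\: S_(l+1)] are
      singletons [{k_l}].  The iterated squares of [e_(k_0)] never vanish: the
      [l]-th one is supported in [S_l] and its coordinate along [e_(k_l)] is
      nonzero.  Hence [E^(2^(n-1)) != 0] whereas [E^(2^(n-1)+1)] is contained in
      [V_n = 0], and the index is [2^(n-1)+1]. *)

(** * Powers of a nonassociative algebra *)

Section Powers.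

Variables (K : fieldType) (E : vectType K) (mul : {bilinear E -> E -> E}).

Lemma powsp_sub_prod (W : {vspace E}) (k : nat) : (2 <= k)%N ->
  (forall i, (0 < i < k)%N ->
     (prodsp mul (powsp mul i) (powsp mul (k - i)) <= W)%VS) ->
  (powsp mul k <= W)%VS.
Proof.
move=> k2 sW; rewrite powspE // big_seq.
elim/big_ind: _ => [|U V UW VW|i]; first exact: sub0v.
  by rewrite subv_add UW VW.
by rewrite mem_index_iota; apply: sW.
Qed.

Lemma powsp_mul (j k : nat) (u v : E) : (0 < j)%N -> (0 < k)%N ->
  u \in powsp mul j -> v \in powsp mul k -> mul u v \in powsp mul (j + k).
Proof.
move=> j0 k0 uj vk; rewrite powspE; last by lia.
have jk : (j < j + k)%N by lia.
rewrite big_add1 big_mkord.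
have jk1 : (j.-1 < (j + k).-1)%N by lia.
apply: (subvP (sumv_sup (Ordinal jk1) _ (subvv _))) => //=.
rewrite prednK // addKn.
by move: (subvv (prodsp mul (powsp mul j) (powsp mul k))) => /prodspP; apply.
Qed.

Lemma powspS_sub (k : nat) : (0 < k)%N -> (powsp mul k.+1 <= powsp mul k)%VS.
Proof.
elim/ltn_ind: k => k IH k0.
have [->|k1] : k = 1%N \/ (1 < k)%N by lia.
  by rewrite powsp1 subvf.
apply: powsp_sub_prod => [|i /andP[i0 ik]]; first by lia.
apply/prodspP => u v ui vi.
have [i1|i1] : i = 1%N \/ (1 < i)%N by lia.
  have -> : k = (i + (k - i))%N by lia.
  apply: powsp_mul; [lia|lia|exact: ui|].
  have ki : (k.+1 - i = (k - i).+1)%N by lia.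
  by rewrite ki in vi; apply: (subvP (IH (k - i)%N _ _)) vi; lia.
have -> : k = (i.-1 + (k.+1 - i))%N by lia.
apply: powsp_mul; [lia|lia| |exact: vi].
have ii : i = i.-1.+1 by lia.
by rewrite ii in ui; apply: (subvP (IH i.-1 _ _)) ui; lia.
Qed.

Lemma powsp_sub (j k : nat) : (0 < j)%N -> (j <= k)%N ->
  (powsp mul k <= powsp mul j)%VS.
Proof.
move=> j0; elim: k => [|k IH] jk; first by lia.
have [<-|jk'] : j = k.+1 \/ (j <= k)%N by lia.
  exact: subvv.
by apply: subv_trans (IH jk'); apply: powspS_sub; lia.
Qed.

End Powers.

(** * Walks in the digraph of the structure matrix *)

Section Walks.

Variables (K : fieldType) (d : nat) (a : 'M[K]_d).

(** The indices at which a walk of length [l] ends, in the digraph with an edge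
    from [i] to [k] when [a i k != 0]. *)
Fixpoint walk_ends (l : nat) : {set 'I_d} :=
  if l is l'.+1 then [set k | [exists i in walk_ends l', a i k != 0]]
  else setT.

Lemma walk_endsSP (l : nat) (k : 'I_d) :
  reflect (exists2 i, i \in walk_ends l & a i k != 0) (k \in walk_ends l.+1).
Proof. by rewrite inE; apply: (iffP exists_inP). Qed.

Lemma walk_endsS_sub (l : nat) : walk_ends l.+1 \subset walk_ends l.
Proof.
elim: l => [|l IH]; first exact: subsetT.
apply/subsetP => k /walk_endsSP[i il aik]; apply/walk_endsSP.
by exists i => //; apply: (subsetP IH).
Qed.

Lemma walk_ends_fixed (l m : nat) :
  walk_ends l.+1 = walk_ends l -> walk_ends (l + m) = walk_ends l.
Proof.
move=> fixl; elim: m => [|m IH]; first by rewrite addn0.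
by rewrite addnS -[RHS]fixl /= IH.
Qed.

(** A digraph all of whose walks are shorter than some bound is acyclic. *)
Variables (N : nat) (walks_bounded : walk_ends N = set0).

Lemma walk_endsS_proper (l : nat) :
  walk_ends l != set0 -> walk_ends l.+1 \proper walk_ends l.
Proof.
move=> l0; rewrite properEneq walk_endsS_sub andbT.
apply: contraNneq l0 => fixl; rewrite -subset0 -walks_bounded.
rewrite -(walk_ends_fixed N fixl) addnC.
by elim: l {fixl} => [|l IH]; rewrite ?addn0 // addnS;
  apply: subset_trans (walk_endsS_sub _) IH.
Qed.

Lemma card_walk_endsS (l : nat) :
  walk_ends l != set0 -> (#|walk_ends l.+1| < #|walk_ends l|)%N.
Proof. by move=> l0; apply: proper_card; apply: walk_endsS_proper. Qed.

(** A digraph on [d] vertices has a walk of length [d - 1] without being cyclic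
    only if it has the largest possible sets of walk endpoints. *)
Lemma card_walk_ends (l : nat) :
  walk_ends d.-1 != set0 -> (l <= d)%N -> #|walk_ends l| = (d - l)%N.
Proof.
move=> last0.
have nonempty m : (m < d)%N -> walk_ends m != set0.
  move=> md; apply: contraNneq last0 => m0.
  have -> : d.-1 = (m + (d.-1 - m))%N by lia.
  elim: (d.-1 - m)%N => [|j /eqP IH]; first by rewrite addn0 m0.
  by rewrite addnS -subset0 -IH walk_endsS_sub.
have upper m : (m <= d)%N -> (#|walk_ends m| + m <= d)%N.
  elim: m => [|m IH] md; first by rewrite addn0 cardsT card_ord.
  by have := card_walk_endsS (nonempty m md); have := IH (ltnW md); lia.
have lower j : (j <= d)%N -> (j <= #|walk_ends (d - j)|)%N.
  elim: j => // j IH jd.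
  have djd : (d - j.+1 < d)%N by lia.
  have := card_walk_endsS (nonempty _ djd).
  have -> : (d - j.+1).+1 = (d - j)%N by lia.
  by have := IH (ltnW jd); lia.
move=> ld; have := upper l ld; have := lower (d - l)%N (leq_subr _ _).
by rewrite subKn //; lia.
Qed.

(** In the extremal case the sets of walk endpoints lose one index at a time. *)
Lemma walk_endsD_singleton (l : nat) :
  walk_ends d.-1 != set0 -> (l < d)%N ->
  exists k, walk_ends l :\: walk_ends l.+1 = [set k].
Proof.
move=> last0 ld; apply/cards1P; apply/eqP.
rewrite cardsD (setIidPr (walk_endsS_sub l)) !card_walk_ends //; last exact: ltnW.
by lia.
Qed.

End Walks.

(** * Evolution algebras *)

Section Evolution.

Variables (K : fieldType) (E : vectType K) (mul : {bilinear E -> E -> E}).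
Variables (d : nat) (e : d.-tuple E) (a : 'M[K]_d).
Variables (be : basis_of fullv e)
  (mul_neq : forall i j : 'I_d, i != j -> mul (tnth e i) (tnth e j) = 0)
  (mul_sq : forall i : 'I_d,
     mul (tnth e i) (tnth e i) = \sum_(k < d) a i k *: tnth e k).

Lemma basis_expansion (x : E) : x = \sum_i coord e i x *: tnth e i.
Proof.
rewrite {1}(coord_basis be (memvf x)).
by apply: eq_bigr => i _; rewrite (tnth_nth 0).
Qed.

Lemma coord_tnth (i j : 'I_d) : coord e j (tnth e i) = (i == j)%:R.
Proof. by rewrite (tnth_nth 0) coord_free // (basis_free be). Qed.

Lemma coord_sum_tnth (c : 'I_d -> K) (k : 'I_d) :
  coord e k (\sum_i c i *: tnth e i) = c k.
Proof.
rewrite linear_sum (bigD1 k) //= linearZ /= coord_tnth eqxx mulr1.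
rewrite big1 ?addr0 // => i ik.
by rewrite linearZ /= coord_tnth (negbTE ik) mulr0.
Qed.

Lemma mul_basis (x y : E) :
  mul x y = \sum_i (coord e i x * coord e i y) *: mul (tnth e i) (tnth e i).
Proof.
rewrite {1}(basis_expansion x) linear_sumlz; apply: eq_bigr => i _.
rewrite {1}(basis_expansion y) linear_sumr (bigD1 i) //= big1 ?addr0.
  by rewrite linearZl_LR linearZr_LR scalerA.
move=> j ji; rewrite linearZl_LR linearZr_LR mul_neq ?scaler0 //.
by rewrite eq_sym.
Qed.

Lemma coord_mul (x y : E) (k : 'I_d) :
  coord e k (mul x y) = \sum_i coord e i x * coord e i y * a i k.
Proof.
rewrite mul_basis linear_sum; apply: eq_bigr => i _.
by rewrite linearZ /= mul_sq coord_sum_tnth.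
Qed.

(** The vectors whose coordinates vanish outside [S]. *)
Definition support_space (S : {set 'I_d}) : {vspace E} :=
  (\sum_(i in S) <[tnth e i]>)%VS.

Lemma support_spaceP (S : {set 'I_d}) (x : E) :
  reflect (forall k, k \notin S -> coord e k x = 0) (x \in support_space S).
Proof.
apply: (iffP idP) => [/memv_sumP[vs vsP ->] k kS | xS].
  rewrite linear_sum big1 // => i iS; have /vlineP[c ->] := vsP i iS.
  by rewrite linearZ /= coord_tnth; case: eqVneq iS kS => [->->|_]; rewrite ?mulr0.
rewrite (basis_expansion x) (bigID (mem S)) /= [X in _ + X]big1 ?addr0.
  by apply: memv_sumr => i _; rewrite memvZ // memv_line.
by move=> i /xS ->; rewrite scale0r.
Qed.

Lemma support_space0 : support_space set0 = 0%VS.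
Proof. by rewrite /support_space big_set0. Qed.

Lemma mul_support_space (l : nat) (x y : E) :
  (x \in support_space (walk_ends a l)) || (y \in support_space (walk_ends a l))
  -> mul x y \in support_space (walk_ends a l.+1).
Proof.
move=> xy; apply/support_spaceP => k kl; rewrite coord_mul big1 // => i _.
have [aik|aik] := eqVneq (a i k) 0; first by rewrite aik mulr0.
have il : i \notin walk_ends a l.
  by apply: contra kl => il; apply/walk_endsSP; exists i.
by case/orP: xy => /support_spaceP xy; rewrite xy // ?mulr0 ?mul0r.
Qed.

Lemma powsp_sub_support (l k : nat) : (2 ^ l < 2 * k)%N ->
  (powsp mul k <= support_space (walk_ends a l))%VS.
Proof.
elim: l k => [|l IH] k lk.
  by apply/subvP => x _; apply/support_spaceP => i; rewrite inE.
have l0 : (0 < 2 ^ l)%N by rewrite expn_gt0.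
rewrite expnS in lk.
apply: powsp_sub_prod => [|i ik]; first by lia.
apply/prodspP => u v ui vi; apply: mul_support_space; apply/orP.
have [il|il] : (2 ^ l < 2 * i)%N \/ (2 ^ l < 2 * (k - i))%N by lia.
  by left; apply: (subvP (IH _ il)).
by right; apply: (subvP (IH _ il)).
Qed.

(** Follow the walk: [e_j^2 * e_i = a_(ji) e_i^2] extends it by the edge from
    [j] to [i]. *)
Lemma walk_square_powsp (l : nat) (i : 'I_d) : i \in walk_ends a l ->
  mul (tnth e i) (tnth e i) \in powsp mul l.+2.
Proof.
elim: l i => [|l IH] i; first by move=> _; apply: (@powsp_mul _ _ mul 1 1);
  rewrite // powsp1 memvf.
case/walk_endsSP => j jl aji.
have jP : mul (mul (tnth e j) (tnth e j)) (tnth e i) \in powsp mul l.+3.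
  rewrite -addn1; apply: powsp_mul => //; first exact: IH.
  by rewrite powsp1 memvf.
have jE : mul (mul (tnth e j) (tnth e j)) (tnth e i) =
    a j i *: mul (tnth e i) (tnth e i).
  rewrite mul_basis (bigD1 i) //= big1 ?addr0 => [|k ki].
    by rewrite coord_tnth eqxx mulr1 mul_sq coord_sum_tnth.
  by rewrite coord_tnth eq_sym (negbTE ki) mulr0 scale0r.
by move: jP; rewrite jE => /(memvZ (a j i)^-1); rewrite scalerA mulVf // scale1r.
Qed.

Lemma nilpotent_walks_bounded (m : nat) :
  powsp mul m = 0%VS -> walk_ends a m = set0.
Proof.
move=> m0; apply/setP => i; rewrite in_set0; apply/negP => im.
have sq_neq0 k j : a k j != 0 -> mul (tnth e k) (tnth e k) != 0.
  move=> akj; apply: contraNneq akj => sq0.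
  by rewrite -(coord_sum_tnth (a k) j) -mul_sq sq0 linear0.
have powm0 v : v \in powsp mul m -> v = 0 by rewrite m0 memv0 => /eqP.
have [m1|m1] := leqP m 1.
  (* For [m <= 1] the power is the whole space, including the convention for
     the zeroth power; it contains [e_i], which is not zero. *)
  have := coord_tnth i i; rewrite (powm0 (tnth e i)); last first.
    by case: m m1 {m0 im powm0} => [|[|]] // _; apply: memvf.
  by rewrite linear0 eqxx => /eqP; rewrite eq_sym oner_eq0.
case: m m1 im {m0} powm0 => [|[|m]] // _ im powm0.
have /walk_endsSP[j jm aji] := im.
have := sq_neq0 _ _ aji; rewrite (powm0 (mul _ _)) ?eqxx //.
by apply: walk_square_powsp; apply: (subsetP (walk_endsS_sub _ _)).
Qed.

Variables (N : nat) (walks_bounded : walk_ends a N = set0).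

(** Squaring maps the coordinate along [k_l] to a nonzero multiple of its square
    along [k_(l+1)]: no other index of [S_l] has an edge to [k_(l+1)], which is
    not in [S_(l+2)]. *)
Lemma iterated_square_neq0 (l : nat) :
  walk_ends a d.-1 != set0 -> (l < d)%N ->
  exists2 x, x \in powsp mul (2 ^ l) & exists2 k,
    walk_ends a l :\: walk_ends a l.+1 = [set k] & coord e k x != 0.
Proof.
move=> last0; elim: l => [|l IH] ld.
  have [k kE] := walk_endsD_singleton walks_bounded last0 ld.
  by exists (tnth e k); [exact: memvf | exists k; rewrite // coord_tnth eqxx oner_eq0].
have [x xP [k kE xk]] := IH (ltnW ld).
have [k' kE'] := walk_endsD_singleton walks_bounded last0 ld.
exists (mul x x).
  by rewrite expnS mul2n -addnn; apply: powsp_mul; rewrite ?expn_gt0.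
exists k' => //.
have /support_spaceP xS : x \in support_space (walk_ends a l).
  by apply: (subvP (@powsp_sub_support l (2 ^ l) _)) xP;
    rewrite ltn_Pmull // expn_gt0.
have : k' \in [set k'] by rewrite in_set1.
rewrite -kE' in_setD => /andP[k'S k'S1].
have only_k i : i != k -> i \in walk_ends a l -> a i k' = 0.
  move=> ik il; apply: contraNeq k'S => aik; apply/walk_endsSP; exists i => //.
  apply: contraNT ik => iS.
  by rewrite -in_set1 -kE in_setD iS.
have akk' : a k k' != 0.
  have /walk_endsSP[i il aik] := k'S1.
  by have [<-//|ik] := eqVneq i k; rewrite only_k ?eqxx in aik.
rewrite coord_mul (bigD1 k) //= big1 ?addr0 => [|i ik].
  by rewrite !mulf_neq0.
have [il|il] := boolP (i \in walk_ends a l).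
  by rewrite only_k // mulr0.
by rewrite xS // !mul0r.
Qed.

Lemma powsp_neq0 (m : nat) : walk_ends a d.-1 != set0 ->
  (0 < m <= 2 ^ d.-1)%N -> powsp mul m != 0%VS.
Proof.
move=> last0 /andP[m0 md].
have d0 : (0 < d)%N.
  by case/set0Pn: last0 => i _; apply: leq_ltn_trans (ltn_ord i).
have dd : (d.-1 < d)%N by lia.
have [x xP [k _ xk]] := iterated_square_neq0 last0 dd.
apply: contraNneq xk => pm0.
have : x \in powsp mul m by apply: (subvP (powsp_sub _ _ md)).
by rewrite pm0 memv0 => /eqP ->; rewrite linear0.
Qed.

End Evolution.

Theorem proposition4p7 (R : realType) (n : nat) (E : vectType R[i])
    (mul : {bilinear E -> E -> E})
    (dimE : \dim {:E} = n)
    (evolE : is_evolution_algebra mul)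
    (nilE : nilpotent_algebra mul) :
  nilpotency_index nilE <> (2 ^ (n - 1) + 1)%N ->
  (nilpotency_index nilE <= 2 ^ (n - 2) + 1)%N.
Proof.
case: evolE => d [e [be mul_neq [a mul_sq]]].
have dn : d = n by rewrite -(size_basis be) dimE.
subst d; rewrite /nilpotency_index.
case: ex_minnP => m /andP[m0 /eqP pm0] minm.
have wm0 := nilpotent_walks_bounded be mul_neq mul_sq pm0.
have sub_supp := powsp_sub_support be mul_neq mul_sq.
have [last0|last0] := eqVneq (walk_ends a n.-1) set0.
  move=> _; apply: minm; rewrite addn1 ltnS leq0n /= -subv0.
  rewrite -(support_space0 e) -last0; apply: sub_supp.
  have [n1|n2] := leqP n 1.
    by have -> : n.-1 = 0%N; [lia | rewrite mulnS].
  have -> : n.-1 = (n - 2).+1 by lia.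
  by rewrite mulnS -expnS; lia.
have n0 : (0 < n)%N.
  by case/set0Pn: last0 => i _; apply: leq_ltn_trans (ltn_ord i).
rewrite subn1 => m_neq; exfalso; apply: m_neq; apply/eqP.
rewrite eqn_leq; apply/andP; split.
  apply: minm; rewrite addn1 ltnS leq0n /= -subv0.
  have /eqP : #|walk_ends a n| = 0%N.
    by rewrite (card_walk_ends wm0) // subnn.
  rewrite cards_eq0 => /eqP last_empty.
  rewrite -(support_space0 e) -last_empty; apply: sub_supp.
  by rewrite mulnS -expnS prednK //; lia.
rewrite addn1 ltnNge; apply/negP => mle.
have := @powsp_neq0 _ _ _ _ _ _ be mul_neq mul_sq _ wm0 m last0.
by rewrite m0 mle pm0 eqxx => /(_ isT).
Qed.
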